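(* Let $L\subseteq\{0,1\}^*\times\mathbb{N}$ be a parameterized problem for which there is an algorithm that decides every instance $(x,k)$ in $k^c\cdot|x|$ time, for some constant $c>0$. Then for every $\varepsilon>0$, every instance $(x,k)$ admits a strict $(|x|^{1+c/(1+\varepsilon)},k^{1+\varepsilon})$-kernel; that is, there is a strict $(a,b)$-kernelization for $L$ with $a(s)=s^{1+c/(1+\varepsilon)}$ and $b(k)=k^{1+\varepsilon}$.
   Context: A strict $(a,b)$-kernelization for a parameterized problem $L$ is an algorithm that, given any instance $(x,k)$, computes in $O(a(|x|))$ time an instance $(x',k')$ such that (i) $(x,k)\in L\iff(x',k')\in L$, (ii) $|x'|+k'\in O(b(k))$, and (iii) $k'\le k$.
   Formalization: The number ε is additionally assumed effective: from m, a fraction within 1/(m+1) of ε can be computed in O(2^m) time (true for all rationals and polynomial-time computable reals); for noncomputable ε the claim fails, by a diagonal problem L whose kernelization would compute ε. *)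

(* Defs.v *)
From HB Require Import structures.
From mathcomp Require Import all_boot all_order all_algebra.
From mathcomp Require Import all_classical all_reals all_analysis.
Set Implicit Arguments.
Unset Strict Implicit.
Unset Printing Implicit Defensive.
Import Order.TTheory GRing.Theory Num.Theory.
Local Open Scope ring_scope.

(* Model of computation: the unit-cost random access machine with addition and
   truncated subtraction (no multiplication, so the model is polynomially
   equivalent to Turing machines).  A program refers to finitely many registers
   r and finitely many unbounded arrays a of natural numbers, both named
   statically; array cells are addressed through the contents of a register. *)
Inductive instr :=
| Const (r n : nat)        (* R[r] := n                           *)
| Add (r r1 r2 : nat)      (* R[r] := R[r1] + R[r2]               *)
| Sub (r r1 r2 : nat)      (* R[r] := max(0, R[r1] - R[r2])       *)
| Read (r a r1 : nat)      (* R[r] := A[a][R[r1]]                 *)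
| Write (a r1 r2 : nat)    (* A[a][R[r1]] := R[r2]                *)
| Jz (r l : nat).          (* if R[r] = 0 then goto l             *)

Definition program := seq instr.

Record config := Config {
  pc : nat;
  regs : nat -> nat;
  arrs : nat -> nat -> nat }.

Definition upd (T : Type) (f : nat -> T) (i : nat) (v : T) : nat -> T :=
  fun j => if j == i then v else f j.

Definition exec (i : instr) (s : config) : config :=
  let: Config p R A := s in
  match i with
  | Const r n => Config p.+1 (upd R r n) A
  | Add r r1 r2 => Config p.+1 (upd R r (R r1 + R r2)%N) A
  | Sub r r1 r2 => Config p.+1 (upd R r (R r1 - R r2)%N) A
  | Read r a r1 => Config p.+1 (upd R r (A a (R r1))) A
  | Write a r1 r2 => Config p.+1 R (upd A a (upd (A a) (R r1) (R r2)))
  | Jz r l => Config (if R r == 0%N then l else p.+1) R A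
  end.

(* A program halts when control leaves it; a halted configuration is a fixed
   point of [step], so being halted after [t] steps means having halted within
   at most [t] steps. *)
Definition halted (P : program) (s : config) : bool := (size P <= pc s)%N.

Definition step (P : program) (s : config) : config :=
  if onth P (pc s) is Some i then exec i s else s.

Definition run (P : program) (t : nat) (s : config) : config :=
  iter t (step P) s.

Definition instance : Type := (seq bool * nat)%type.

(* The instance (x, k) is given by k in register 0, |x| in register 1, and the
   bits of x in array 0; all other registers and cells hold 0.  In particular
   the parameter is accessible in constant time, as is necessary for time
   bounds that depend on |x| only. *)
Definition input (i : instance) : config :=
  Config 0
    (fun r => match r with 0 => i.2 | 1 => size i.1 | _ => 0 end)%N
    (fun a j => if a == 0%N then nat_of_bool (nth false i.1 j) else 0%N).

Definition represents (s : config) (i : instance) : Prop :=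
  [/\ regs s 0 = i.2, regs s 1 = size i.1 &
      forall j, (j < size i.1)%N -> arrs s 0 j = nth false i.1 j].

Definition decides (P : program) (L : set instance) (time : instance -> nat) :
  Prop :=
  forall i, let s := run P (time i) (input i) in
    halted P s /\ (regs s 0 <> 0%N <-> L i).

Definition computes (P : program) (f : instance -> instance)
    (time : instance -> nat) : Prop :=
  forall i, let s := run P (time i) (input i) in
    halted P s /\ represents s (f i).

(* The summand 1 only matters where g vanishes (k = 0 or |x| = 0): there f has
   to be bounded, whereas f <= C * g would force f = 0.  The estimate is
   required at all arguments, not just at large ones. *)
Definition big_O (R : realType) (I : Type) (f : I -> nat) (g : I -> R) : Prop :=
  exists C : R, forall i, (f i)%:R <= C * (g i + 1).

Definition strict_kernelization (R : realType) (L : set instance)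
    (a b : R -> R) (P : program) : Prop :=
  exists (K : instance -> instance) (time : instance -> nat),
    [/\ computes P K time,
        big_O time (fun i => a (size i.1)%:R),
        forall i, L i <-> L (K i),
        big_O (fun i => size (K i).1 + (K i).2)%N (fun i => b i.2%:R) &
        forall i, ((K i).2 <= i.2)%N].

(* Effectiveness of a nonnegative real constant: from m one can compute, in
   O(2^m) time, a fraction p / q at distance at most 1 / (m + 1) from e.  This
   is far weaker than polynomial-time computability of e.  A kernelization whose
   bounds involve a real exponent needs such a condition: for a suitable problem
   it yields approximations of that exponent. *)
Definition effective_real (R : realType) (e : R) : Prop :=
  exists (P : program) (time : nat -> nat),
    big_O time (fun m => 2%:R ^+ m : R) /\
    forall m, let s := run P (time m) (input ([::], m)) in
      [/\ halted P s, (0 < regs s 1)%N &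
          `|(regs s 0)%:R / (regs s 1)%:R - e| <= m.+1%:R^-1].

Lemma effective_real_rat (R : realType) (q : rat) :
  0 <= q -> effective_real (ratr q : R).
Proof.
move=> q0; have [n nE] : exists n : nat, numq q = n%:Z.
  by exists `|numq q|%N; rewrite gez0_abs // numq_ge0.
have [d dE] : exists d : nat, denq q = d%:Z.
  by exists `|denq q|%N; rewrite gez0_abs // denq_ge0.
have d0 : (0 < d)%N by rewrite -ltz_nat -dE denq_gt0.
exists [:: Const 0 n; Const 1 d], (fun=> 2%N); split.
  exists 2; move=> m; rewrite ler_peMr //.
  by rewrite lerDr exprn_ge0.
move=> m /=; split=> //; rewrite /= /upd /=.
by rewrite /ratr nE dE !pmulrn subrr normr0 invr_ge0.
Qed.

(* Main.v *)
Require Import Defs.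
From HB Require Import structures.
From mathcomp Require Import all_boot all_order all_algebra.
From mathcomp Require Import all_classical all_reals all_analysis.
From mathcomp Require Import zify lra.
Set Implicit Arguments.
Unset Strict Implicit.
Unset Printing Implicit Defensive.
Import Order.TTheory GRing.Theory Num.Theory.

(* If n = |x| is O(k^(1+eps)), then the instance is its own kernel; otherwise
   k^c * n = O(n^(1+c/(1+eps))), so there is time to solve it and to output a
   fixed yes- or no-instance, chosen with least parameter so that the kernel is
   strict.  Both estimates leave a constant factor of slack, which makes the
   case distinction computable: with a = floor(log2 k) and b = floor(log2 n), it
   suffices to compare a * (1 + eps) with b up to an additive constant.  As
   a <= b, an approximation p / q of eps with error 1 / (b + 1) is good enough;
   it is available in time O(2^b) = O(n), and a * (p + q) and b * q are computed
   by O(log n) additions, however large p and q are. *)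

Local Open Scope nat_scope.

(** * Composition of programs *)

Definition registers := nat -> nat.
Definition arrays := nat -> nat -> nat.

Lemma run_add (P : program) (t u : nat) (s : config) :
  run P (t + u) s = run P u (run P t s).
Proof. by rewrite /run addnC iterD. Qed.

Lemma runS (P : program) (t : nat) (s : config) :
  run P t.+1 s = run P t (step P s).
Proof. exact: iterSr. Qed.

Lemma step_Jz (P : program) (r l : nat) (R : registers) (A : arrays) :
  step (Jz r l :: P) (Config 0 R A) = Config (if R r == 0 then l else 1) R A.
Proof. by []. Qed.

Lemma step_halted (P : program) (s : config) : halted P s -> step P s = s.
Proof. by move=> hs; rewrite /step onth_default. Qed.

Lemma run_halted (P : program) (t : nat) (s : config) :
  halted P s -> run P t s = s.
Proof. by move=> hs; elim: t => //= t; rewrite /run /= => ->; exact: step_halted. Qed.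

(** The time is only an upper bound, so branches of different lengths compose. Halting exactly at
    [size P] makes control fall through into whatever code follows. *)
Definition reaches (P : program) (t : nat) (R : registers) (A : arrays)
    (Post : registers -> arrays -> Prop) : Prop :=
  exists t' R' A',
    [/\ t' <= t, run P t' (Config 0 R A) = Config (size P) R' A' & Post R' A'].

Lemma reaches_weaken (P : program) (t u : nat) (R : registers) (A : arrays)
    (Post Post' : registers -> arrays -> Prop) :
  t <= u -> (forall R' A', Post R' A' -> Post' R' A') ->
  reaches P t R A Post -> reaches P u R A Post'.
Proof.
move=> tu PP' [t' [R' [A' [t't E PRA]]]]; exists t', R', A'.
by split=> //; [exact: leq_trans tu | exact: PP'].
Qed.

(** Jump targets are absolute addresses, so code placed at offset [o] needs them shifted. *)
Definition move_instr (o : nat) (i : instr) : instr :=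
  if i is Jz r l then Jz r (o + l) else i.

Definition move_code (o : nat) (P : program) : program := map (move_instr o) P.

Definition move_pc (o : nat) (s : config) : config :=
  Config (o + pc s) (regs s) (arrs s).

Lemma exec_move (o : nat) (i : instr) (s : config) :
  exec (move_instr o i) (move_pc o s) = move_pc o (exec i s).
Proof.
case: s => p R A; case: i => *; rewrite /move_pc /= ?addnS //.
by case: ifP; rewrite ?addnS.
Qed.

(** Both runs proceed in lockstep until [P] halts. From then on [P] alone idles, whereas the
    composite would continue into [E]; hence [t'] may be smaller than [t]. *)
Lemma run_move (B P E : program) (t : nat) (s : config) :
  pc (run P t s) = size P ->
  exists2 t', t' <= t &
    run (B ++ move_code (size B) P ++ E) t' (move_pc (size B) s) =
    move_pc (size B) (run P t s).
Proof.
elim: t s => [|t IH] s; first by exists 0.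
have [hs|nhs] := leqP (size P) (pc s).
  by rewrite (@run_halted P) // => _; exists 0.
rewrite !runS => /IH [t' t't E']; exists t'.+1 => //.
rewrite runS -E'; congr (run _ _ _).
rewrite /step /= onth_cat ltnNge leq_addr /= addKn onth_cat size_map nhs onth_map.
case: (onth P (pc s)) (onthTE P (pc s)) => [i _|]; last by rewrite nhs.
exact: exec_move.
Qed.

Lemma reaches_move (B P E : program) (t : nat) (R : registers) (A : arrays)
    (Post : registers -> arrays -> Prop) :
  reaches P t R A Post ->
  exists t' R' A',
    [/\ t' <= t,
        run (B ++ move_code (size B) P ++ E) t' (Config (size B) R A) =
        Config (size B + size P) R' A' & Post R' A'].
Proof.
move=> [t1 [R' [A' [t1t E1 PRA]]]].
have /(run_move B E) [t' t't1] : pc (run P t1 (Config 0 R A)) = size P by rewrite E1.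
rewrite E1 /move_pc /= addn0 => E2; exists t', R', A'.
by split=> //; exact: leq_trans t1t.
Qed.

Definition seqp (P1 P2 : program) : program := P1 ++ move_code (size P1) P2.

Lemma size_seqp (P1 P2 : program) : size (seqp P1 P2) = size P1 + size P2.
Proof. by rewrite size_cat size_map. Qed.

Lemma move_code0 (P : program) : move_code 0 P = P.
Proof. by rewrite /move_code (@eq_map _ _ _ id) ?map_id // => -[]. Qed.

Lemma reaches_seq (P1 P2 : program) (t1 t2 : nat) (R : registers) (A : arrays)
    (Mid Post : registers -> arrays -> Prop) :
  reaches P1 t1 R A Mid ->
  (forall R' A', Mid R' A' -> reaches P2 t2 R' A' Post) ->
  reaches (seqp P1 P2) (t1 + t2) R A Post.
Proof.
move=> /(reaches_move [::] (move_code (size P1) P2)) /=.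
rewrite move_code0 => -[u1 [R1 [A1 [ut1 E1 M]]]] /(_ _ _ M).
move=> /(reaches_move P1 [::]); rewrite cats0 => -[u2 [R2 [A2 [ut2 E2 PRA]]]].
exists (u1 + u2), R2, A2; rewrite run_add E1 E2 size_seqp; split=> //.
exact: leq_add.
Qed.

Definition ifnz (r : nat) (P : program) : program :=
  Jz r (size P).+1 :: move_code 1 P.

Lemma reaches_ifnz (r : nat) (P : program) (t : nat) (R : registers)
    (A : arrays) (Post : registers -> arrays -> Prop) :
  (R r = 0 -> Post R A) -> (R r <> 0 -> reaches P t R A Post) ->
  reaches (ifnz r P) t.+1 R A Post.
Proof.
move=> P0 P1; case: (eqVneq (R r) 0) => Rr.
  exists 1, R, A; split=> //; last exact: P0.
  by rewrite /run /step /= Rr /= size_map.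
have /P1 : R r <> 0 by exact/eqP.
move=> /(reaches_move [:: Jz r (size P).+1] [::]); rewrite cats0.
move=> [t' [R' [A' [t't E PRA]]]]; exists t'.+1, R', A'; split=> //.
by rewrite runS step_Jz (negbTE Rr) /= E size_map.
Qed.

(* Register [z] has to hold 0 whenever the body ends: it makes the backward
   jump unconditional. *)
Definition while (r z : nat) (P : program) : program :=
  Jz r (size P).+2 :: move_code 1 P ++ [:: Jz z 0].

(** [I j] is the loop invariant with [j] iterations left. An iteration costs its body and two jumps;
    the final exit test is the extra step. *)
Lemma reaches_while (r z : nat) (P : program) (t : nat)
    (I : nat -> registers -> arrays -> Prop) :
  (forall R A, I 0 R A -> R r = 0) ->
  (forall j R A, I j.+1 R A ->
     R r <> 0 /\ reaches P t R A (fun R' A' => I j R' A' /\ R' z = 0)) ->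
  forall j R A, I j R A -> reaches (while r z P) (j * t.+2).+1 R A (I 0).
Proof.
move=> I0 IS; elim=> [|j IH] R A Ij.
  exists 1, R, A; split=> //.
  by rewrite /run /step /= (I0 _ _ Ij) /= size_cat size_map addn1.
have [/eqP/negbTE Rr] := IS _ _ _ Ij.
move=> /(reaches_move [:: Jz r (size P).+2] [:: Jz z 0]).
move=> [u1 [R1 [A1 [ut1 E1 [I1 z1]]]]].
have [u2 [R2 [A2 [ut2 E2 PRA]]]] := IH _ _ I1.
exists (1 + (u1 + (1 + u2))), R2, A2; split=> //; first by lia.
rewrite -E2 add1n runS step_Jz Rr !run_add E1 /=; congr (run _ _ _).
rewrite /run /step /= add1n /= onth_cat size_map ltnn subnn /=.
by rewrite z1.
Qed.

Definition jump_free (i : instr) : bool := if i is Jz _ _ then false else true.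

Lemma reaches_line (P : program) (R : registers) (A : arrays)
    (Post : registers -> arrays -> Prop) :
  all jump_free P ->
  (let s := foldl (fun s i => exec i s) (Config 0 R A) P in
   Post (regs s) (arrs s)) ->
  reaches P (size P) R A Post.
Proof.
move=> jfP PRA.
set s := foldl _ _ _ in PRA; exists (size P), (regs s), (arrs s); split=> //.
(* The induction needs an already executed prefix [Q1] in front of the remaining code [Q2]. *)
suff H Q1 Q2 R1 A1 : all jump_free Q2 ->
    run (Q1 ++ Q2) (size Q2) (Config (size Q1) R1 A1) =
    foldl (fun s i => exec i s) (Config (size Q1) R1 A1) Q2 /\
    pc (run (Q1 ++ Q2) (size Q2) (Config (size Q1) R1 A1)) = size (Q1 ++ Q2).
  by have [E pcE] := H [::] P R A jfP; move: pcE; rewrite E -/s; case: (s) => p ? ? /= ->.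
elim: Q2 Q1 R1 A1 => [|i Q2 IH] Q1 R1 A1; first by rewrite cats0.
case/andP=> jfi /IH {}IH.
rewrite [size (_ :: _)]/= runS.
have -> : step (Q1 ++ i :: Q2) (Config (size Q1) R1 A1) =
          exec i (Config (size Q1) R1 A1).
  by rewrite /step /= onth_cat ltnn subnn.
rewrite -cat_rcons.
move: (IH (rcons Q1 i)) jfi; rewrite size_rcons.
by case: i {IH} => // > H _; exact: H.
Qed.

(** * Running a program inside its own set of registers and arrays *)

Definition embed_instr (f : nat -> nat) (N : nat) (i : instr) : instr :=
  match i with
  | Const r n => Const (f r) n
  | Add r r1 r2 => Add (f r) (f r1) (f r2)
  | Defs.Sub r r1 r2 => Defs.Sub (f r) (f r1) (f r2)
  | Read r a r1 => Read (f r) (f a) (f r1)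
  | Write a r1 r2 => Write (f a) (f r1) (f r2)
  | Jz r l => Jz (f r) (minn l N)
  end.

(* Jump targets are clamped so that the embedded program can only halt by
   reaching the instruction that follows it. *)
Definition embed (f : nat -> nat) (P : program) : program :=
  map (embed_instr f (size P)) P.

Lemma size_embed (f : nat -> nat) (P : program) : size (embed f P) = size P.
Proof. exact: size_map. Qed.

(** Simulation invariant between an original run [s] and an embedded run [S]. The [minn] reflects
    the clamped jumps; the last two clauses let foreign data survive the simulation. *)
Definition mirrors (f : nat -> nat) (R0 : registers) (A0 : arrays) (N : nat)
    (s S : config) : Prop :=
  [/\ pc S = minn (pc s) N,
      forall r, regs S (f r) = regs s r,
      forall a j, arrs S (f a) j = arrs s a j,
      forall r, (forall x, r <> f x) -> regs S r = R0 r &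
      forall a, (forall x, a <> f x) -> arrs S a = A0 a].

Lemma updE (T : Type) (g : nat -> T) (i : nat) (v : T) : upd g i v i = v.
Proof. by rewrite /upd eqxx. Qed.

Lemma upd_neq (T : Type) (g : nat -> T) (i j : nat) (v : T) :
  j <> i -> upd g i v j = g j.
Proof. by rewrite /upd => /eqP/negbTE ->. Qed.

Lemma upd_inj (T : Type) (f : nat -> nat) (g h : nat -> T) (i j : nat) (v : T) :
  injective f -> (forall r, g (f r) = h r) ->
  upd g (f i) v (f j) = upd h i v j.
Proof. by move=> fI gh; rewrite /upd (inj_eq fI); case: ifP. Qed.

Lemma mirrors_step (f : nat -> nat) (R0 : registers) (A0 : arrays)
    (P : program) (s S : config) :
  injective f -> mirrors f R0 A0 (size P) s S ->
  mirrors f R0 A0 (size P) (step P s) (step (embed f P) S).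
Proof.
move=> fI [pcE rE aE rF aF].
have [hs|nhs] := leqP (size P) (pc s).
  have hS : halted (embed f P) S.
    by rewrite /halted size_embed pcE; move/minn_idPr: hs => ->.
  by rewrite !step_halted.
have {}pcE : pc S = pc s by rewrite pcE; apply/minn_idPl/ltnW.
rewrite /step pcE onth_map.
case: (onth P (pc s)) (onthTE P (pc s)) => [i _|]; last by rewrite nhs.
case: s S pcE rE aE rF aF nhs => p R A [_ R' A'] /= -> rE aE rF aF nhs.
case: i => //= *; split=> //=; rewrite ?(minn_idPl nhs) //.
all: try by move=> *; rewrite ?rE ?aE; exact: upd_inj.
all: try by move=> r rf; rewrite upd_neq; auto.
  move=> b j; rewrite !rE /upd (inj_eq fI); case: eqP => // _; rewrite ?aE.
  by case: ifP.
by rewrite rE; case: ifP => // _; apply/esym/minn_idPl.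
Qed.

Lemma reaches_embed (f : nat -> nat) (P : program) (t : nat) (s : config)
    (R : registers) (A : arrays) :
  injective f -> pc s = 0 ->
  (forall r, R (f r) = regs s r) -> (forall a j, A (f a) j = arrs s a j) ->
  halted P (run P t s) ->
  reaches (embed f P) t R A (fun R' A' =>
    [/\ forall r, R' (f r) = regs (run P t s) r,
        forall r, (forall x, r <> f x) -> R' r = R r &
        forall a, (forall x, a <> f x) -> A' a = A a]).
Proof.
move=> fI s0 Rs As hs.
have H : mirrors f R A (size P) (run P t s) (run (embed f P) t (Config 0 R A)).
  elim: (t) => [|u IH]; first by split=> //=; rewrite s0 min0n.
  exact: mirrors_step.
case E : (run _ _ (Config _ _ _)) H => [p R' A'] [/= pE rE _ rF aF].
exists t, R', A'; rewrite E pE; split=> //.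
(* Halting puts the original counter at or beyond [size P], so the clamped one is exactly at the
   end. *)
by congr Config; rewrite size_embed; apply/minn_idPr.
Qed.

(** * The kernelization program *)

(* Registers 23, 26, 29 and 32 are scratch: the constant 1, the current power
   of 2, the loop condition and [src + 1]. *)
Definition log_block (dst src : nat) : program :=
  seqp [:: Const 23 1; Const 26 1; Const dst 0; Add 32 src 23;
           Add 29 26 26; Defs.Sub 29 32 29]
    (while 29 2 [:: Add 26 26 26; Add dst dst 23; Add 29 26 26; Defs.Sub 29 32 29]).

Definition agree_off (s : seq nat) (R R' : registers) : Prop :=
  forall r, r \notin s -> R' r = R r.

Ltac simpl_upd :=
  cbn [foldl exec regs arrs];
  repeat first [rewrite updE
    | match goal with |- context [upd ?g ?i ?v ?j] =>
        rewrite (@upd_neq _ g i j v); [|by lia] end].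

Lemma reaches_log (dst src : nat) (R : registers) (A : arrays) :
  R 2 = 0 -> dst \notin [:: 2; 23; 26; 29; 32] ->
  src \notin [:: dst; 23; 26; 29; 32] ->
  reaches (log_block dst src) (6 * trunc_log 2 (R src) + 7) R A (fun R' A' =>
    [/\ R' dst = trunc_log 2 (R src),
        agree_off [:: dst; 23; 26; 29; 32] R R' & A' = A]).
Proof.
move=> R2; rewrite !inE !negb_or => /and5P[d2 d23 d26 d29 d32].
move=> /and5P[sd s23 s26 s29 s32]; set n := R src.
(* With [j] rounds left, register 29 holds the truncated difference of n + 1 and 2^(dst+1), which is
   nonzero exactly while 2^(dst+1) <= n. *)
pose I j (R' : registers) (A' : arrays) :=
  [/\ [/\ R' dst + j = trunc_log 2 n, R' 26 = 2 ^ R' dst,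
        R' 29 = n.+1 - 2 ^ (R' dst).+1, R' 23 = 1 & R' 32 = n.+1],
      agree_off [:: dst; 23; 26; 29; 32] R R' & A' = A].
apply: (@reaches_weaken _ (6 + (trunc_log 2 n * 6).+1) _ _ _ (I 0)).
- by lia.
- by move=> R' A' [[+ _ _ _ _] ? ?]; rewrite addn0 => ?; split.
apply: (reaches_seq (Mid := I (trunc_log 2 n))).
  apply: reaches_line => //; split=> //.
    by split; simpl_upd; rewrite ?expn1; lia.
  move=> r; rewrite !inE !negb_or => /and5P[r1 r2 r3 r4 r5].
  by simpl_upd.
apply: reaches_while.
  move=> R' A' [[+ _ -> _ _] _ _]; rewrite addn0 => ->.
  by apply/eqP; rewrite subn_eq0; exact: trunc_log_ltn.
move=> j R' A' [[E1 E2 E3 E4 E5] agr ->]; split.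
  rewrite E3.
  (* For n = 0 the logarithm is 0 by convention, so no round would be left. *)
  have n0 : 0 < n by case: (n) E1 => //; rewrite trunc_log0; lia.
  have := trunc_logP (isT : 1 < 2) n0; rewrite -E1.
  have := @leq_pexp2l 2 (R' dst).+1 (R' dst + j.+1) isT.
  by rewrite addnS ltnS leq_addr => /(_ isT); lia.
apply: reaches_line => //; split; last first.
  by simpl_upd; rewrite agr ?R2 // !inE negb_or (eq_sym 2) d2.
split=> //.
  by split; simpl_upd; rewrite ?E2 ?E4 ?E5 ?addn1 ?expnS; lia.
move=> r rin; rewrite -(agr r rin); move: rin.
rewrite !inE !negb_or => /and5P[r1 r2 r3 r4 r5].
by simpl_upd.
Qed.

Definition mul_block (dst x y : nat) : program :=
  seqp [:: Const 23 1; Const dst 0; Add 26 x 2]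
    (while 26 2 [:: Add dst dst y; Defs.Sub 26 26 23]).

(** Repeated addition of [y] takes time linear in the factor [x] alone. The logarithms can therefore
    play the role of [x], while [y] comes from the approximation of eps and may be huge. *)
Lemma reaches_mul (dst x y : nat) (R : registers) (A : arrays) :
  R 2 = 0 -> dst \notin [:: 2; 23; 26] ->
  x \notin [:: dst; 23; 26] -> y \notin [:: dst; 23; 26] ->
  reaches (mul_block dst x y) (4 * R x + 4) R A (fun R' A' =>
    [/\ R' dst = R x * R y, agree_off [:: dst; 23; 26] R R' & A' = A]).
Proof.
move=> R2; rewrite !inE !negb_or => /and3P[d2 d23 d26].
move=> /and3P[xd x23 x26] /and3P[yd y23 y26].
pose I j (R' : registers) (A' : arrays) :=
  [/\ [/\ R' dst + j * R y = R x * R y, R' 26 = j & R' 23 = 1],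
      agree_off [:: dst; 23; 26] R R' & A' = A].
apply: (@reaches_weaken _ (3 + (R x * 4).+1) _ _ _ (I 0)); first by lia.
  by move=> R' A' [[+ _ _] ? ?]; rewrite addn0 => ?; split.
apply: (reaches_seq (Mid := I (R x))).
  apply: reaches_line => //; split=> //.
    by split; simpl_upd; rewrite ?R2; lia.
  move=> r; rewrite !inE !negb_or => /and3P[r1 r2 r3].
  by simpl_upd.
apply: reaches_while; first by move=> R' A' [[]].
move=> j R' A' [[E1 E2 E3] agr ->]; split; first by rewrite E2.
apply: reaches_line => //; split; last first.
  by simpl_upd; rewrite agr ?R2 // !inE negb_or (eq_sym 2) d2.
split=> //.
  have yE : R' y = R y by apply: agr; rewrite !inE !negb_or yd y23 y26.
  by split; simpl_upd; rewrite ?yE ?E2 ?E3 ?subn1 // -E1 mulSn addnA.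
move=> r rin; rewrite -(agr r rin); move: rin.
rewrite !inE !negb_or => /and3P[r1 r2 r3].
by simpl_upd.
Qed.

(** * Writing a fixed instance and solving the given one *)

Fixpoint write_bits (j : nat) (x : seq bool) : program :=
  if x is b :: x' then
    seqp [:: Const 8 j; Const 11 b; Write 0 8 11] (write_bits j.+1 x')
  else [::].

Lemma reaches_write_bits (x : seq bool) (j : nat) (R : registers) (A : arrays) :
  reaches (write_bits j x) (3 * size x) R A (fun R' A' =>
    [/\ agree_off [:: 8; 11] R R',
        forall i, i < size x -> A' 0 (j + i) = nth false x i &
        forall i, i < j -> A' 0 i = A 0 i]).
Proof.
elim: x j R A => [|b x IH] j R A; first exact: reaches_line.
rewrite [size _]/= mulnS; apply: (reaches_seq (Mid := fun R' A' =>
    [/\ agree_off [:: 8; 11] R R', A' 0 j = b &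
        forall i, i < j -> A' 0 i = A 0 i])).
  apply: reaches_line => //; split=> [r||i ij]; try by simpl_upd.
  by rewrite !inE negb_or => /andP[r1 r2]; simpl_upd.
move=> R1 A1 [agr1 A1j A1i]; apply: reaches_weaken (IH j.+1 R1 A1) => //.
move=> R2 A2 [agr2 A2i A2j]; split=> [r rin|[|i] ix|i ij].
- by rewrite agr2 ?agr1.
- by rewrite addn0 A2j.
- by rewrite addnS -addSn A2i.
- by rewrite A2j ?A1i // leqW.
Qed.

Definition write_instance (x : instance) : program :=
  seqp (write_bits 0 x.1) [:: Const 0 x.2; Const 1 (size x.1)].

Lemma reaches_write_instance (x : instance) (R : registers) (A : arrays) :
  reaches (write_instance x) (3 * size x.1 + 2) R A (fun R' A' =>
    represents (Config 0 R' A') x /\ agree_off [:: 0; 1; 8; 11] R R').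
Proof.
apply: reaches_seq; first exact: reaches_write_bits.
move=> R1 A1 [agr A1x _]; apply: reaches_line => //; split.
  by split=> [||j jx]; simpl_upd => //; exact: A1x.
move=> r; rewrite !inE !negb_or => /and4P[r0 r1 r8 r11].
by simpl_upd; rewrite agr // !inE negb_or r8.
Qed.

(** [Add 3 1 2] copies |x| to where the embedded decider expects it; k and the bits of x, at index
    0, are already in place. The answer is saved in register 5; [no] is written first and
    overwritten by [yes] if the answer is nonzero. Leftover cells are harmless, since [represents]
    constrains only cells below the output length. *)
Definition solve_block (P : program) (yes no : instance) : program :=
  seqp [:: Add 3 1 2] (seqp (embed (muln 3) P) (seqp [:: Add 5 0 2]
    (seqp (write_instance no) (ifnz 5 (write_instance yes))))).

Definition solve_time (t : nat) (yes no : instance) : nat :=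
  1 + (t + (1 + (3 * size no.1 + 2 + (3 * size yes.1 + 2).+1))).

(** What must survive until the decider starts: k and |x|, the zero register, and the decider's own
    registers. *)
Definition pristine (i : instance) (R : registers) : Prop :=
  forall r, (r < 3) || (3 %| r) -> R r = regs (input i) r.

Lemma pristine_agree (i : instance) (s : seq nat) (R R' : registers) :
  all (fun r => ~~ ((r < 3) || (3 %| r))) s ->
  agree_off s R R' -> pristine i R -> pristine i R'.
Proof.
move=> /allP sP agr prR r rP; rewrite agr ?prR //.
by apply/negP => /sP; rewrite rP.
Qed.

Lemma reaches_solve (P : program) (yes no i : instance) (t : nat)
    (R : registers) (A : arrays) :
  pristine i R -> (forall a, 3 %| a -> A a = arrs (input i) a) ->
  halted P (run P t (input i)) ->
  reaches (solve_block P yes no) (solve_time t yes no) R A (fun R' A' =>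
    represents (Config 0 R' A')
      (if regs (run P t (input i)) 0 == 0 then no else yes)).
Proof.
move=> prR prA hP.
apply: (reaches_seq (Mid := fun R' A' =>
    [/\ forall r, R' (3 * r) = regs (input i) r, R' 2 = 0 & A' = A])).
  apply: reaches_line => //; split=> // [r|]; last by simpl_upd; rewrite prR.
  have [->|r1] := eqVneq r 1; first by simpl_upd; rewrite !prR // addn0.
  simpl_upd; rewrite prR ?dvdn_mulr ?orbT //.
  by case: r r1 => [|[|r]].
move=> R1 A1 [R1E R12 ->]; apply: reaches_seq.
  apply: (@reaches_embed _ _ t (input i)) => //; first by move=> ? ?; lia.
  move=> [|a] j; first by rewrite muln0 prA.
  by rewrite prA ?dvdn_mulr //= muln_eq0.
move=> R2 A2 [R2E R2F _]; set ans := regs (run P t (input i)) 0.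
apply: (reaches_seq (Mid := fun R' _ => R' 5 = ans)).
  have R22 : R2 2 = 0 by rewrite R2F // => x; lia.
  by apply: reaches_line => //; simpl_upd; rewrite R22 addn0; exact: (R2E 0).
move=> R3 A3 R35; apply: reaches_seq; first exact: reaches_write_instance.
move=> R4 A4 [rep4 agr4]; have R45 : R4 5 = ans by rewrite agr4.
apply: reaches_ifnz => [|/eqP]; rewrite R45; first by move->.
move=> /negbTE ->; apply: reaches_weaken (reaches_write_instance _ _ _) => //.
by move=> ? ? [].
Qed.

(* Registers and arrays: the decider owns the indices 3r, the approximation of
   eps owns 3r + 4, and local variables are congruent to 2 modulo 3.  Registers
   0 and 1 keep k and |x|, which is already the output when the instance is its
   own kernel; register 2 is always 0. *)
Definition kernel_block (E P : program) (yes no : instance) : program :=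
  seqp [:: Defs.Sub 5 1 0] (ifnz 5
    (seqp (log_block 8 1) (seqp (log_block 11 0) (seqp [:: Add 4 8 2]
    (seqp (embed (fun r => 3 * r + 4) E) (seqp [:: Add 14 4 7]
    (seqp (mul_block 17 11 14) (seqp (mul_block 20 8 7)
    (seqp [:: Defs.Sub 5 20 17] (ifnz 5 (solve_block P yes no))))))))))).

(** Passing the first test, |x| > k, secures |x| > 0 and a <= b for what follows. The second test is
    b <= a * (1 + p / q) with the denominator cleared. *)
Lemma reaches_kernel (E P : program) (yes no i : instance) (te t : nat) :
  let b := trunc_log 2 (size i.1) in
  let a := trunc_log 2 i.2 in
  let se := run E te (input ([::], b)) in
  let p := regs se 0 in
  let q := regs se 1 in
  let s := run P t (input i) in
  halted E se -> halted P s ->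
  reaches (kernel_block E P yes no)
    (1 + (if size i.1 <= i.2 then 0 else
      6 * b + 7 + (6 * a + 7 + (1 + (te + (1 + (4 * a + 4 + (4 * b + 4 +
        (1 + (if b * q <= a * (p + q) then 0
              else solve_time t yes no).+1)))))))).+1)
    (regs (input i)) (arrs (input i))
    (fun R' A' => represents (Config 0 R' A')
      (if size i.1 <= i.2 then i
       else if b * q <= a * (p + q) then i
       else if regs s 0 == 0 then no else yes)).
Proof.
move=> b a se p q s hE hP.
have rep R A : pristine i R -> A 0 = arrs (input i) 0 ->
    represents (Config 0 R A) i.
  by move=> prR A0; split; rewrite /= ?prR // A0.
pose R0 := regs (input i); pose A0 := arrs (input i).
apply: (reaches_seq (Mid := fun R A =>
    [/\ R 5 = size i.1 - i.2, agree_off [:: 5] R0 R & A = A0])).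
  apply: reaches_line => //; split=> // r; rewrite inE => r5.
  by simpl_upd.
move=> R1 A1 [R15 agr1 ->].
have pr1 : pristine i R1 by exact: pristine_agree agr1 _.
(* The approximation of eps must start from zeroed registers; only register 4, its register 0, will
   receive [b]. *)
have z1 x : R1 (3 * x + 4) = 0.
  by rewrite agr1 ?inE; [rewrite addnC | lia].
apply: reaches_ifnz; rewrite R15 => /eqP; rewrite subn_eq0.
  by move=> ->; exact: rep.
move=> /negbTE ->.
have := @reaches_log 8 1 R1 A0 (pr1 2 isT) isT isT.
rewrite (pr1 1) // => /reaches_seq; apply=> R2 A2 [R28 agr2 ->].
have pr2 : pristine i R2 by exact: pristine_agree agr2 _.
have := @reaches_log 11 0 R2 A0 (pr2 2 isT) isT isT.
rewrite (pr2 0) // => /reaches_seq; apply=> R3 A3 [R311 agr3 ->].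
have pr3 : pristine i R3 by exact: pristine_agree agr3 _.
have z3 x : R3 (3 * x + 4) = 0.
  by rewrite agr3 ?agr2 // !inE; lia.
apply: (reaches_seq (Mid := fun R A =>
    [/\ R 4 = b, agree_off [:: 4] R3 R & A = A0])).
  apply: reaches_line => //; split=> //.
    by simpl_upd; rewrite (pr3 2) // addn0 agr3.
  by move=> r; rewrite inE => r4; simpl_upd.
move=> R4 A4 [R44 agr4 ->].
have pr4 : pristine i R4 by exact: pristine_agree agr4 _.
apply: reaches_seq.
  apply: (@reaches_embed _ _ te (input ([::], b))) => //.
  - by move=> ? ?; lia.
  - move=> [|r]; first by rewrite R44.
    by rewrite agr4 ?inE ?z3; [case: r | lia].
  - by move=> x j; rewrite /A0 /= addnC /= nth_nil; case: ifP.
rewrite -/se => R5 A5 [R5E R5F A5F].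
have pr5 : pristine i R5.
  by move=> r rP; rewrite R5F ?pr4 // => x xE; move: rP; rewrite xE; lia.
have R54 : R5 4 = p := R5E 0.
have R57 : R5 7 = q := R5E 1.
have R58 : R5 8 = b by rewrite R5F ?agr4 ?agr3 // => x; lia.
have R511 : R5 11 = a by rewrite R5F ?agr4 // => x; lia.
apply: (reaches_seq (Mid := fun R A =>
    [/\ R 14 = p + q, agree_off [:: 14] R5 R & A = A5])).
  apply: reaches_line => //; split=> //; first by simpl_upd; rewrite R54 R57.
  by move=> r; rewrite inE => r14; simpl_upd.
move=> R6 A6 [R614 agr6 ->].
have pr6 : pristine i R6 by exact: pristine_agree agr6 _.
have := @reaches_mul 17 11 14 R6 A5 (pr6 2 isT) isT isT isT.
rewrite R614 (agr6 11) // R511 => /reaches_seq; apply=> R7 A7 [R717 agr7 ->].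
have pr7 : pristine i R7 by exact: pristine_agree agr7 _.
have := @reaches_mul 20 8 7 R7 A5 (pr7 2 isT) isT isT isT.
rewrite (agr7 8) // (agr6 8) // R58 (agr7 7) // (agr6 7) // R57.
move=> /reaches_seq; apply=> R8 A8 [R820 agr8 ->].
have pr8 : pristine i R8 by exact: pristine_agree agr8 _.
apply: (reaches_seq (Mid := fun R A =>
    [/\ R 5 = b * q - a * (p + q), pristine i R & A = A5])).
  apply: reaches_line => //; split=> //.
    by simpl_upd; rewrite R820 agr8 ?R717.
  by apply: (@pristine_agree i [:: 5] R8) => // r; rewrite inE => r5; simpl_upd.
move=> R9 A9 [R95 pr9 ->].
(* The approximation writes only to arrays 3y + 4, so x and the decider's arrays are untouched. *)
have A5E x : 3 %| x -> A5 x = A0 x by move=> x3; apply: A5F => y; lia.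
apply: reaches_ifnz; rewrite R95 => /eqP; rewrite subn_eq0.
  by move=> ->; apply: rep => //; exact: A5E.
by move=> /negbTE ->; exact: reaches_solve.
Qed.

(** * Correctness of the case distinction *)

Local Open Scope ring_scope.

Lemma ler_wpowR2l (R : realType) (r x y : R) :
  0 <= r -> 0 <= x -> x <= y -> x `^ r <= y `^ r.
Proof.
move=> r0 x0 xy; apply: ge0_ler_powR => //; rewrite nnegrE //.
exact: le_trans xy.
Qed.

(* The [+ 1] covers [k = 0]. *)
Lemma exp_trunc_log_le (R : realType) (k : nat) (r : R) :
  0 <= r -> 2%:R `^ ((trunc_log 2 k)%:R * r) <= k%:R `^ r + 1.
Proof.
move=> r0; rewrite powRrM powR_mulrn //.
have [->|k0] := posnP k.
  by rewrite trunc_log0 expr0 powR1 lerDr powR_ge0.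
rewrite -natrX (@le_trans _ _ (k%:R `^ r)) ?lerDl //.
by rewrite ler_wpowR2l // ler_nat trunc_logP.
Qed.

Lemma le_exp_trunc_log (R : realType) (k : nat) :
  k%:R <= 2%:R `^ ((trunc_log 2 k)%:R + 1) :> R.
Proof.
rewrite -[1]/(1%:R) -natrD powR_mulrn // -natrX ler_nat addn1 ltnW //.
exact: trunc_log_ltn.
Qed.

(** As a <= b + 1, an error of 1 / (b + 1) in eps changes a * eps by at most 1. The test thus gives
    b <= a * (1 + eps) + 1, and n < 2^(b+1) is at most 4 times 2 to the power a * (1 + eps). *)
Lemma test_accepts (R : realType) (eps : R) (k n p q : nat) :
  0 < eps -> (0 < q)%N -> (k <= n)%N ->
  let a := trunc_log 2 k in let b := trunc_log 2 n in
  `|p%:R / q%:R - eps| <= b.+1%:R^-1 -> (b * q <= a * (p + q))%N ->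
  n%:R <= 4 * (k%:R `^ (1 + eps) + 1).
Proof.
move=> eps0 q0 kn a b pq test.
have ab : a%:R <= b.+1%:R :> R by rewrite ler_nat leqW // leq_trunc_log.
have ba : b%:R <= a%:R * (1 + eps) + 1 :> R.
  have q0' : 0 < q%:R :> R by rewrite ltr0n.
  have : b%:R <= a%:R * (p%:R / q%:R + 1) :> R.
    rewrite -(ler_pM2r q0') -mulrA mulrDl divfK ?gt_eqF // mul1r.
    by rewrite -natrD -!natrM ler_nat.
  have : a%:R * (p%:R / q%:R - eps) <= 1 :> R.
    apply: (@le_trans _ _ (a%:R * b.+1%:R^-1)); last by rewrite ler_pdivrMr ?mul1r.
    by rewrite ler_wpM2l // (le_trans (ler_norm _)).
  by lra.
apply: le_trans (le_exp_trunc_log R n) _.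
apply: (@le_trans _ _ (2 `^ (a%:R * (1 + eps) + 2%:R))).
  by apply: ler_powR => //; [rewrite ler1n | rewrite -/b; lra].
rewrite powRD ?pnatr_eq0 ?implybT // powR_mulrn // mulrC -natrX.
rewrite ler_wpM2l // exp_trunc_log_le //; lra.
Qed.

(** The same error estimate gives a * (1 + eps) <= b + 1. Hence k < 2^(a+1) is at most 4 * n^(1 / (1
    + eps)); raising this to the power c and multiplying by n gives the bound. *)
Lemma test_rejects (R : realType) (c eps : R) (k n p q : nat) :
  0 < c -> 0 < eps -> (0 < q)%N -> (0 < n)%N -> (k <= n)%N ->
  let a := trunc_log 2 k in let b := trunc_log 2 n in
  `|p%:R / q%:R - eps| <= b.+1%:R^-1 -> (a * (p + q) < b * q)%N ->
  k%:R `^ c * n%:R <= 4 `^ c * n%:R `^ (1 + c / (1 + eps)).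
Proof.
move=> c0 eps0 q0 n0 kn a b pq test.
have ab : a%:R <= b.+1%:R :> R by rewrite ler_nat leqW // leq_trunc_log.
have ba : a%:R * (1 + eps) <= b%:R + 1 :> R.
  have q0' : 0 < q%:R :> R by rewrite ltr0n.
  have : a%:R * (p%:R / q%:R + 1) <= b%:R :> R.
    rewrite -(ler_pM2r q0') -mulrA mulrDl divfK ?gt_eqF // mul1r.
    by rewrite -natrD -!natrM ler_nat ltnW.
  have : a%:R * (eps - p%:R / q%:R) <= 1 :> R.
    apply: (@le_trans _ _ (a%:R * b.+1%:R^-1)); last by rewrite ler_pdivrMr ?mul1r.
    by rewrite ler_wpM2l // (le_trans (ler_norm _)) // distrC.
  by lra.
have e0 : 0 < 1 + eps by lra.
(* Division by 1 + eps leaves at most 1 of the additive 1; the other 1 comes from bounding k by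
   2^(a+1). Together they produce the factor 4. *)
have {}ba : a%:R + 1 <= b%:R / (1 + eps) + 2%:R :> R.
  have : a%:R <= (b%:R + 1) / (1 + eps) :> R by rewrite ler_pdivlMr.
  have : (1 + eps)^-1 <= 1 by rewrite invf_le1 //; lra.
  by lra.
have kb : k%:R <= 4 * n%:R `^ (1 + eps)^-1 :> R.
  apply: le_trans (le_exp_trunc_log R k) _.
  apply: le_trans (ler_powR _ ba) _; first by rewrite ler1n.
  rewrite powRD ?pnatr_eq0 ?implybT // powR_mulrn // mulrC -natrX.
  rewrite ler_wpM2l // powRrM powR_mulrn // -natrX.
  by rewrite ler_wpowR2l ?invr_ge0 ?(ltW e0) // ler_nat trunc_logP.
have n0' : n%:R != 0 :> R by rewrite pnatr_eq0 -lt0n.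
rewrite powRD ?n0' ?implybT // powRr1 // mulrA mulrAC ler_wpM2r //.
rewrite [c / _]mulrC powRrM -powRM ?powR_ge0 //.
by rewrite ler_wpowR2l // ltW.
Qed.

(** * The fixed outputs and the final estimates *)

(** Used for [L] and for its complement: a member of least parameter can replace every member
    without increasing the parameter. A classical choice suffices, because the instance is
    hard-coded into the program. For an empty set the claim is vacuous. *)
Lemma least_parameter (L : set instance) :
  exists y, forall i, L i -> L y /\ (y.2 <= i.2)%N.
Proof.
have [[i0 Li0]|nL] := pselect (exists i, L i); last first.
  by exists ([::], 0%N) => i Li; case: nL; exists i.
have exk : exists k, `[< exists x, L (x, k) >].
  by exists i0.2; apply/asboolP; exists i0.1; rewrite -surjective_pairing.
have [k /asboolP[x Lxk] kmin] := ex_minnP exk.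
exists (x, k) => i Li; split=> //; apply: kmin; apply/asboolP.
by exists i.1; rewrite -surjective_pairing.
Qed.

Lemma big_O_ge0 (R : realType) (I : Type) (f : I -> nat) (g : I -> R) :
  (forall i, 0 <= g i) -> big_O f g ->
  exists2 C, 0 <= C & forall i, (f i)%:R <= C * (g i + 1).
Proof.
move=> g0 [C fC]; exists `|C| => // i; apply: le_trans (fC i) _.
by rewrite ler_wpM2r ?ler_norm // addr_ge0.
Qed.

Theorem theorem3 (R : realType) (L : set instance) (c : R) (c_gt0 : 0 < c)
    (L_decided : exists (P : program) (time : instance -> nat),
       decides P L time /\
       big_O time (fun i => i.2%:R `^ c * (size i.1)%:R))
    (eps : R) (eps_gt0 : 0 < eps) (eps_eff : effective_real eps) :
  exists P : program,
    strict_kernelization L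
      (fun s => s `^ (1 + c / (1 + eps))) (fun k => k `^ (1 + eps)) P.
Proof.
have [P [tP [Pdec tPO]]] := L_decided.
have [|CP CP0 tPle] := big_O_ge0 _ tPO.
  by move=> i; rewrite mulr_ge0 ?powR_ge0.
have [E [tE [tEO Eeff]]] := eps_eff.
have [|CE CE0 tEle] := big_O_ge0 _ tEO.
  by move=> m; rewrite exprn_ge0.
have [yes yesP] := least_parameter L.
have [no noP] := least_parameter (~` L)%classic.
pose e := 1 + c / (1 + eps).
have e1 : 1 <= e by rewrite lerDl divr_ge0 ?addr_ge0 ?ltW.
(* The part of [solve_time] that does not depend on the decider's running time. *)
pose S := (3 * size no.1 + 3 * size yes.1 + 7)%N.
(* The summands pay, in turn, for the overhead 20 n + 28, the approximation of eps, the decider, and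
   the fixed cost [S]. *)
pose C1 := 28 + CE + (CP * 4 `^ c + CP) + S%:R.
pose S2 := (size yes.1 + yes.2 + (size no.1 + no.2))%N.
pose Q := kernel_block E P yes no.
exists Q.
(* [Q] is fixed beforehand; choice only collects the running time and the output of each instance
   into functions. *)
suff /choice[K KP] : forall i, exists y : nat * instance,
    [/\ halted Q (run Q y.1 (input i)) /\ represents (run Q y.1 (input i)) y.2,
        y.1%:R <= C1 * ((size i.1)%:R `^ e + 1),
        L i <-> L y.2,
        (size y.2.1 + y.2.2)%:R <= (8 + S2%:R) * (i.2%:R `^ (1 + eps) + 1) &
        (y.2.2 <= i.2)%N].
  exists (fun i => (K i).2), (fun i => (K i).1); split.
  - by move=> i; have [] := KP i.
  - by exists C1 => i; have [] := KP i.
  - by move=> i; have [] := KP i.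
  - by exists (8 + S2%:R) => i; have [] := KP i.
  - by move=> i; have [] := KP i.
move=> i; set n := size i.1; set k := i.2.
set b := trunc_log 2 n; set a := trunc_log 2 k.
have [hE q0 pq] := Eeff b; have [hP ansP] := Pdec i.
have := reaches_kernel yes no (i := i) hE hP.
move: q0 pq ansP; set p := regs _ 0; set q := regs _ 1; set ans := regs _ 0.
cbv zeta; rewrite -/p -/q -/a -/b -/n -/k -/ans => q0 pq ansP.
move=> [t [R' [A' [tle runE]]]].
set y := (if _ then _ else _) => repy.
exists (t, y); rewrite /= -[input i]/(Config 0 (regs (input i)) (arrs (input i))).
rewrite runE /halted /=.
suff [tle' Ly yle yk] : [/\ t%:R <= C1 * (n%:R `^ e + 1), L i <-> L y,
        (size y.1 + y.2)%:R <= (8 + S2%:R) * (k%:R `^ (1 + eps) + 1) &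
        (y.2 <= k)%N] by split=> //; split.
have ge0 : 0 <= n%:R `^ e by rewrite powR_ge0.
have ke0 : 0 <= k%:R `^ (1 + eps) by rewrite powR_ge0.
have C4 : 0 <= CP * 4 `^ c by rewrite mulr_ge0 ?powR_ge0.
have S0 : 0 <= S%:R :> R by [].
have S20 : 0 <= S2%:R :> R by [].
have C1g : 28 <= C1 by rewrite /C1; lra.
rewrite /y; case: (leqP n k) tle => [nk tle|kn tle].
  split=> //.
    apply: (@le_trans _ _ 2%:R); first by rewrite ler_nat.
    by nra.
  have kle : k%:R <= k%:R `^ (1 + eps) :> R.
    have [->|k0] := posnP k; first by rewrite powR_ge0.
    by rewrite le1r_powR ?ler1n // lerDl ltW.
  have nk' : n%:R <= k%:R :> R by rewrite ler_nat.
  by rewrite natrD -/n -/k; nra.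
have n0 : (0 < n)%N by exact: leq_ltn_trans kn.
have bn : (b <= n)%N.
  by apply: leq_trans (trunc_logP (isT : (1 < 2)%N) n0); exact/ltnW/ltn_expl.
have ab : (a <= b)%N by rewrite leq_trunc_log // ltnW.
have nle : n%:R <= n%:R `^ e :> R by rewrite le1r_powR ?ler1n.
have kn' : k%:R <= n%:R :> R by rewrite ler_nat ltnW.
(* The approximation takes time O(2^b), and 2^b <= n <= n^e. *)
have tEn : (tE b)%:R <= CE * (n%:R `^ e + 1).
  apply: le_trans (tEle b) _; rewrite ler_wpM2l // lerD2r.
  by rewrite -natrX (le_trans _ nle) // ler_nat trunc_logP.
case: (leqP (b * q) (a * (p + q))) tle => [test tle|test tle].
  split=> //.
    (* The loops cost 10 a + 10 b, at most 20 n because a <= b <= n. *)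
    have {}tle : (t <= 20 * n + 28 + tE b)%N.
      by move: tle bn ab => /=; generalize (tE b); generalize b a n; clear; lia.
    apply: (@le_trans _ _ (20 * n + 28 + tE b)%N%:R); first by rewrite ler_nat.
    rewrite (natrD _ _ (tE b)) natrD natrM.
    by rewrite /C1; nra.
  (* As k < n, the total n + k is at most 2 n, which turns the factor 4 into 8. *)
  have := test_accepts eps_gt0 q0 (ltnW kn) pq test.
  by rewrite natrD -/n -/k; nra.
have tPn : (tP i)%:R <= CP * (4 `^ c * n%:R `^ e + 1).
  apply: le_trans (tPle i) _; rewrite ler_wpM2l // lerD2r.
  exact: test_rejects (ltnW kn) pq test.
have [Lz zk] : (L i <-> L (if ans == 0%N then no else yes)) /\
    ((if ans == 0%N then no else yes).2 <= k)%N.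
  case: eqP ansP => [-> [_ Li]|ans0 [/(_ ans0) Li _]].
    have nLi : ~ L i by move=> /Li.
    by have [nLno nok] := noP i nLi; split.
  by have [Lyes yesk] := yesP i Li; split.
split=> //.
  have {}tle : (t <= 20 * n + 28 + tE b + tP i + S)%N.
    move: tle bn ab => /=; rewrite /solve_time /S.
    by generalize (tE b) (tP i); generalize b a n; clear; lia.
  apply: (@le_trans _ _ (20 * n + 28 + tE b + tP i + S)%N%:R).
    by rewrite ler_nat.
  rewrite (natrD _ _ S) (natrD _ _ (tP i)) (natrD _ _ (tE b)) natrD natrM.
  by rewrite /C1; nra.
apply: (@le_trans _ _ S2%:R); last by nra.
by rewrite ler_nat; case: ifP => _; [exact: leq_addl | exact: leq_addr].
Qed.
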